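(* Let $n$ be a positive integer that is not of the form $p^m$ with $p$ a prime and $m$ a non-negative integer, and let $C_n$ be the cyclic group of order $n$. Then the power graph $\mathcal{P}(C_n)$ is not a complete multipartite graph.
   Context: The power graph $\mathcal{P}(\mathbb{G})$ of a finite group $\mathbb{G}$ is the simple undirected graph with vertex set $\mathbb{G}$ in which two distinct elements $x,y$ are adjacent if and only if one of them is an integral power of the other. A graph is complete multipartite if its vertex set can be partitioned into independent sets such that any two vertices in different parts are adjacent. *)

(* Defs.v *)
From mathcomp Require Import all_boot all_order all_algebra all_fingroup all_solvable.

Set Implicit Arguments.
Unset Strict Implicit.
Unset Printing Implicit Defensive.

Record sgraph := SGraph {
  vertex :> finType;
  adj : vertex -> vertex -> Prop;
  adj_sym : forall x y, adj x y -> adj y x;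
  adj_irrefl : forall x, ~ adj x x
}.

Definition independent (G : sgraph) (A : {set G}) : Prop :=
  forall x y, x \in A -> y \in A -> ~ adj x y.

(* The number of parts is unconstrained: edgeless graphs (one part) and
   complete graphs (singleton parts) are both complete multipartite. *)
Definition complete_multipartite (G : sgraph) : Prop :=
  exists P : {set {set G}},
    [/\ partition P [set: G],
        forall A, A \in P -> independent A
      & forall A B, A \in P -> B \in P -> A <> B ->
          forall x y, x \in A -> y \in B -> adj x y].

Definition expgz (gT : finGroupType) (x : gT) (k : int) : gT :=
  match k with
  | Posz m => (x ^+ m)%g
  | Negz m => (x ^- m.+1)%g   (* Negz m encodes - (m + 1) *)
  end.

Definition power_adj (gT : finGroupType) (x y : gT) : Prop :=
  x <> y /\ ((exists k : int, y = expgz x k) \/ (exists k : int, x = expgz y k)).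

Lemma power_adj_sym (gT : finGroupType) (x y : gT) :
  power_adj x y -> power_adj y x.
Proof. by move=> [nxy [h|h]]; split; [move/esym|right|move/esym|left]. Qed.

Lemma power_adj_irrefl (gT : finGroupType) (x : gT) : ~ power_adj x x.
Proof. by case. Qed.

Definition power_graph (gT : finGroupType) : sgraph :=
  SGraph (@power_adj_sym gT) (@power_adj_irrefl gT).

(* Main.v *)
Require Import Defs.
From mathcomp Require Import all_boot all_order all_algebra all_fingroup all_solvable.

(** In a complete multipartite graph non-adjacency is transitive, its classes
    being the parts ([nadj_trans]).  This fails in the power graph of a finite
    group whose order is divisible by two distinct primes [p] and [q].  One of
    them, say [q], is odd ([two_primes_of_not_prime_power]).  By Cauchy's theorem
    there are [a] of order [p] and [b] of order [q].  Adjacency forces one order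
    to divide the other ([power_adj_order]), so [a] is adjacent to neither [b]
    nor [b^-1].  Yet [b] and [b^-1] are powers of each other, and distinct because
    [q > 2], hence adjacent. *)

(** Vertices in different parts are adjacent, so each missing edge keeps its
    endpoints in one part; two missing edges with a common endpoint then put all
    three vertices in the same independent set. *)
Lemma nadj_trans {G : sgraph} {x y z : G} :
  complete_multipartite G -> ~ adj x y -> ~ adj y z -> ~ adj x z.
Proof.
case=> P [partP indP adjP]; have [/eqP covP _ _] := and3P partP.
have inP w : pblock P w \in P by rewrite pblock_mem // covP inE.
have memP w : w \in pblock P w by rewrite mem_pblock covP inE.
have same_part u v : ~ adj u v -> pblock P u = pblock P v.
  move=> nuv; apply/eqP/negPn/negP=> /eqP neq.
  by apply: nuv; apply: adjP neq _ _ (memP u) (memP v).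
move=> /same_part exy /same_part eyz.
by apply: (indP _ (inP x)); rewrite ?memP // exy eyz memP.
Qed.

Lemma order_expgz (gT : finGroupType) (x : gT) (k : int) :
  #[expgz x k]%g %| #[x]%g.
Proof. by case: k => m /=; rewrite ?orderV orderXdvd. Qed.

Lemma power_adj_order {gT : finGroupType} {x y : gT} :
  power_adj x y -> (#[x]%g %| #[y]%g) || (#[y]%g %| #[x]%g).
Proof.
by case=> _ [] [k ->]; rewrite order_expgz ?orbT.
Qed.

Lemma power_adjV {gT : finGroupType} {x : gT} :
  2 < #[x]%g -> power_adj x x^-1%g.
Proof.
move=> x_gt2; split; last by left; exists (Negz 0).
move=> xV; have: #[x]%g %| 2 by rewrite order_dvdn expgS expg1 {2}xV mulgV.
by move/(dvdn_leq (isT : 0 < 2)); rewrite leqNgt x_gt2.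
Qed.

(** The primes are ordered so that the second is odd: an element of order 2 would
    be its own inverse and could not provide the adjacent pair. *)
Lemma two_primes_of_not_prime_power {n : nat} : 0 < n ->
  ~ (exists p m : nat, prime p /\ n = p ^ m) ->
  exists p q, [/\ prime p, prime q, p %| n, q %| n & p != q /\ 2 < q].
Proof.
move=> n_gt0 n_not_pp.
have n_gt1 : 1 < n.
  rewrite ltn_neqAle n_gt0 andbT eq_sym; apply/eqP=> n1.
  by apply: n_not_pp; exists 2, 0.
have p_pr := pdiv_prime n_gt1; have p_dv := pdiv_dvd n.
move: (pdiv n) p_pr p_dv => p p_pr p_dv.
have [q /andP[q_pr q_dv] neq_qp] : exists2 q, prime q && (q %| n) & q != p.
  have : ~~ p.-nat n.
    apply/negP=> /part_pnat_id; rewrite p_part => n_pp.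
    by apply: n_not_pp; exists p, (logn p n).
  rewrite /pnat n_gt0 => /allPn[q]; rewrite mem_primes n_gt0 /=.
  by exists q.
have [q_gt2 | q_le2] := ltnP 2 q; first by exists p, q; rewrite eq_sym.
have q2 : q = 2 by apply/eqP; rewrite eqn_leq q_le2 prime_gt1.
exists q, p; split=> //; split=> //.
by rewrite ltn_neqAle prime_gt1 // andbT -q2.
Qed.

Theorem lemma2p1 (n : nat) (n_gt0 : 0 < n)
    (n_not_pp : ~ exists p m : nat, prime p /\ n = p ^ m)
    (gT : finGroupType) (gT_cyclic : cyclic [set: gT])
    (gT_order : #|[set: gT]| = n) :
  ~ complete_multipartite (power_graph gT).
Proof.
move=> multP.
have [p [q [p_pr q_pr p_dv q_dv [neq_pq q_gt2]]]] :=
  two_primes_of_not_prime_power n_gt0 n_not_pp.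
rewrite -gT_order in p_dv q_dv.
have [a _ oa] := Cauchy p_pr p_dv; have [b _ ob] := Cauchy q_pr q_dv.
have nadj_a (c : gT) : #[c]%g = q -> ~ power_adj a c.
  move=> oc /power_adj_order; rewrite oa oc !dvdn_prime2 //.
  by rewrite [q == p]eq_sym orbb (negPf neq_pq).
have nadj_ba : ~ power_adj b a by move/power_adj_sym; apply: nadj_a.
have nadj_abV : ~ power_adj a b^-1%g by apply: nadj_a; rewrite orderV.
apply: (nadj_trans (G := power_graph gT) multP nadj_ba nadj_abV).
by apply: power_adjV; rewrite ob.
Qed.
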